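(* Let $n\ge1$ and $m\ge2$. For $1\le j\le n$ put $\gamma_j:=h_{j-1}\cdots h_1\,u\,h_1\cdots h_{j-1}\in Z_n(D_{\mathbb{Z}_m})$ (so $\gamma_1=u$). Then the element $$\theta_n:=\gamma_n\gamma_{n-1}\cdots\gamma_1$$ is contained in the center of $Z_n(D_{\mathbb{Z}_m})$.
   Context: $D_{\mathbb{Z}_m}$ is the orbifold given by the cyclic group $\mathbb{Z}_m$ of order $m$ acting on a disk $D$ by rotations about its center. Its orbifold braid group $Z_n(D_{\mathbb{Z}_m})$ is the orbifold fundamental group of the quotient orbifold of $\{(x_1,\dots,x_n)\in D^n\mid x_i\ne g(x_j)\ \forall g\in\mathbb{Z}_m,\ i\neq j\}$ by $\mathbb{Z}_m^n\rtimes S_n$. By a known earlier theorem, which also serves to fix the generators, it has the presentation with generators $h_1,\dots,h_{n-1},u$ and defining relations $u^m=1$; $h_{j-1}h_jh_{j-1}=h_jh_{j-1}h_j$ for $2\le j<n$; $[h_k,h_l]=1$ for $|k-l|\ge2$; $[u,h_j]=1$ for $2\le j<n$; and (if $n\ge2$) $[h_1uh_1,u]=1$. *)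

(* Defs.v *)
From HB Require Import structures.
From mathcomp Require Import all_boot.
From mathcomp Require Import boolp classical_sets.

Set Implicit Arguments.
Unset Strict Implicit.
Unset Printing Implicit Defensive.

Local Open Scope quotient_scope.
Local Open Scope group_scope.

Definition center (G : groupType) : set G := [set z | forall x : G, commute z x].
Arguments center : clear implicits.

(* A letter (x, true) stands for the generator x, and (x, false) for its
   formal inverse. *)
Definition word (X : Type) := seq (X * bool).

Definition letter_inv {X : Type} (a : X * bool) : X * bool := (a.1, ~~ a.2).

Definition word_inv {X : Type} (w : word X) : word X := rev (map letter_inv w).

Definition word_comm {X : Type} (v w : word X) : word X :=
  word_inv v ++ word_inv w ++ v ++ w.

(* [word_eqv R] is the least congruence on words that contains R and lets
   a letter cancel against its inverse. *)
Inductive word_eqv (X : Type) (R : word X -> word X -> Prop) :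
    word X -> word X -> Prop :=
| WeqvRel v w of R v w : word_eqv R v w
| WeqvCancel a : word_eqv R [:: a; letter_inv a] [::]
| WeqvRefl w : word_eqv R w w
| WeqvSym v w of word_eqv R v w : word_eqv R w v
| WeqvTrans v w z of word_eqv R v w & word_eqv R w z : word_eqv R v z
| WeqvCat v v' w w' of word_eqv R v v' & word_eqv R w w' :
    word_eqv R (v ++ w) (v' ++ w').

Section PresentedGroup.
Variables (X : choiceType) (R : word X -> word X -> Prop).
Implicit Types v w : word X.

Definition word_eqvb : rel (word X) := fun v w => `[< word_eqv R v w >].

Lemma word_eqvb_equiv : equiv_class_of word_eqvb.
Proof.
split=> [w|v w|w v z /asboolP vw /asboolP wz].
- by apply/asboolP; apply: WeqvRefl.
- by apply/asboolP/asboolP; apply: WeqvSym.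
- by apply/asboolP; apply: WeqvTrans vw wz.
Qed.

Canonical word_eqvb_equiv_rel := EquivRelPack word_eqvb_equiv.

Definition presented_group := {eq_quot word_eqvb}.

HB.instance Definition _ := Choice.on presented_group.

Definition word_class (w : word X) : presented_group := \pi_presented_group w.

Lemma word_classP v w : word_class v = word_class w <-> word_eqv R v w.
Proof.
by split=> [/eqmodP /asboolP //|vw]; apply/eqmodP/asboolP.
Qed.

Lemma letter_invK : involutive (@letter_inv X).
Proof. by case=> x b; rewrite /letter_inv /= negbK. Qed.

Lemma word_invK : involutive (@word_inv X).
Proof.
move=> w; rewrite /word_inv map_rev revK -map_comp -[RHS]map_id.
by apply: eq_map => a /=; rewrite letter_invK.
Qed.

Lemma word_eqv_invr w : word_eqv R (w ++ word_inv w) [::].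
Proof.
elim: w => [|a w IHw]; first exact: WeqvRefl.
rewrite /word_inv map_cons rev_cons -cats1 cat_cons catA -cat1s.
apply: (WeqvTrans _ (WeqvCancel R a)).
apply: (WeqvCat (v' := [:: a]) (WeqvRefl _ _)).
exact: (WeqvCat (v' := [::]) IHw (WeqvRefl _ _)).
Qed.

Lemma word_eqv_invl w : word_eqv R (word_inv w ++ w) [::].
Proof. by have := word_eqv_invr (word_inv w); rewrite word_invK. Qed.

Lemma word_eqv_inv v w : word_eqv R v w -> word_eqv R (word_inv v) (word_inv w).
Proof.
move=> vw; apply: (@WeqvTrans _ _ _ (word_inv v ++ (w ++ word_inv w))).
  rewrite -[X in word_eqv _ X _]cats0.
  exact: WeqvCat (WeqvRefl _ _) (WeqvSym (word_eqv_invr w)).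
rewrite catA -[X in word_eqv _ _ X]cat0s; apply: WeqvCat (WeqvRefl _ _).
apply: WeqvTrans (word_eqv_invl v).
exact: WeqvCat (WeqvRefl _ _) (WeqvSym vw).
Qed.

Definition pg_one : presented_group := word_class [::].
Definition pg_mul (a b : presented_group) : presented_group :=
  word_class (repr a ++ repr b).
Definition pg_inv (a : presented_group) : presented_group :=
  word_class (word_inv (repr a)).

Lemma repr_word_class w : word_eqv R (repr (word_class w)) w.
Proof. by apply/word_classP; rewrite /word_class reprK. Qed.

Lemma pg_mulE v w : pg_mul (word_class v) (word_class w) = word_class (v ++ w).
Proof. by apply/word_classP; apply: WeqvCat; apply: repr_word_class. Qed.

Lemma pg_invE w : pg_inv (word_class w) = word_class (word_inv w).
Proof. by apply/word_classP/word_eqv_inv/repr_word_class. Qed.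

Lemma word_class_repr (a : presented_group) : word_class (repr a) = a.
Proof. exact: reprK. Qed.

Lemma pg_mulA : associative pg_mul.
Proof.
move=> a b c; rewrite -[a]word_class_repr -[b]word_class_repr.
by rewrite -[c]word_class_repr !pg_mulE catA.
Qed.

Lemma pg_mul1 : left_id pg_one pg_mul.
Proof. by move=> a; rewrite -[a]word_class_repr pg_mulE. Qed.

Lemma pg_mulr1 : right_id pg_one pg_mul.
Proof. by move=> a; rewrite -[a]word_class_repr pg_mulE cats0. Qed.

Lemma pg_mulV : left_inverse pg_one pg_inv pg_mul.
Proof.
move=> a; rewrite -[a]word_class_repr pg_invE pg_mulE.
exact/word_classP/word_eqv_invl.
Qed.

Lemma pg_mulrV : right_inverse pg_one pg_inv pg_mul.
Proof.
move=> a; rewrite -[a]word_class_repr pg_invE pg_mulE.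
exact/word_classP/word_eqv_invr.
Qed.

HB.instance Definition _ :=
  isGroup.Build presented_group pg_mulA pg_mul1 pg_mulr1 pg_mulV pg_mulrV.

Lemma word_class_nil : word_class [::] = 1.
Proof. by []. Qed.

Lemma word_class_cat v w : word_class (v ++ w) = word_class v * word_class w.
Proof. by rewrite -pg_mulE. Qed.

Lemma word_class_inv w : word_class (word_inv w) = (word_class w)^-1.
Proof. by rewrite -pg_invE. Qed.

Lemma word_class_rel v w : R v w -> word_class v = word_class w.
Proof. by move=> Rvw; apply/word_classP/WeqvRel. Qed.

Definition word_eval (G : groupType) (f : X -> G) (w : word X) : G :=
  \prod_(a <- w) (if a.2 then f a.1 else (f a.1)^-1).

(* The universal property of the presentation. *)
Lemma presented_group_univ (G : groupType) (f : X -> G) :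
    (forall v w, R v w -> word_eval f v = word_eval f w) ->
  exists! phi : presented_group -> G,
    {morph phi : a b / a * b} /\ forall x, phi (word_class [:: (x, true)]) = f x.
Proof.
move=> fR.
have f_cat v w : word_eval f (v ++ w) = word_eval f v * word_eval f w.
  exact: big_cat.
have f_eqv v w : word_eqv R v w -> word_eval f v = word_eval f w.
  elim=> {v w} [v w /fR //|[x b]|//|//|v w z _ -> _ -> //|].
    rewrite /word_eval !big_cons big_nil mulg1.
    by case: b; rewrite /= ?mulgV ?mulVg.
  by move=> v v' w w' _ fv _ fw; rewrite !f_cat fv fw.
have fE w : word_eval f (repr (word_class w)) = word_eval f w.
  exact/f_eqv/repr_word_class.
exists (fun a => word_eval f (repr a)); split=> [|phi [phiM phiX]].
  split=> [a b|x]; last by rewrite fE /word_eval big_seq1.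
  rewrite -[a]word_class_repr -[b]word_class_repr -word_class_cat.
  by rewrite !fE f_cat.
apply/funext => a; rewrite -{2}[a]word_class_repr.
have phi1 : phi 1 = 1.
  by apply: (@mulgI _ (phi 1)); rewrite -phiM !mulg1.
have phiV b : phi b^-1 = (phi b)^-1.
  by apply: (@mulgI _ (phi b)); rewrite -phiM !mulgV.
elim: (repr a) => [|[x b] w IHw]; first by rewrite /word_eval big_nil.
rewrite -cat1s f_cat word_class_cat phiM IHw; congr (_ * _).
rewrite /word_eval big_seq1 /=; case: b; first by rewrite phiX.
by rewrite -[[:: _]]/(word_inv [:: (x, true)]) word_class_inv phiV phiX.
Qed.

End PresentedGroup.

(* The generators: [Some j] is h_j for 1 <= j < n, and [None] is u. *)
Definition braid_gen (n : nat) := option {j : nat | 1 <= j < n}.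

Definition u_word (n : nat) : word (braid_gen n) := [:: (None, true)].

(* Empty outside of the range 1 <= j < n. *)
Definition h_word (n j : nat) : word (braid_gen n) :=
  if insub j is Some i then [:: (Some i, true)] else [::].

Inductive orbifold_braid_rel (n m : nat) :
    word (braid_gen n) -> word (braid_gen n) -> Prop :=
| RelTorsion :
    orbifold_braid_rel m (flatten (nseq m (u_word n))) [::]
| RelBraid j of 2 <= j < n :
    orbifold_braid_rel m
      (h_word n j.-1 ++ h_word n j ++ h_word n j.-1)
      (h_word n j ++ h_word n j.-1 ++ h_word n j)
| RelFar k l of 1 <= k < n & 1 <= l < n & (k + 2 <= l) || (l + 2 <= k) :
    orbifold_braid_rel m (word_comm (h_word n k) (h_word n l)) [::]
| RelUComm j of 2 <= j < n :
    orbifold_braid_rel m (word_comm (u_word n) (h_word n j)) [::]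
| RelUH of 2 <= n :
    orbifold_braid_rel m
      (word_comm (h_word n 1 ++ u_word n ++ h_word n 1) (u_word n)) [::].

(* Z_n(D_{Z_m}), the orbifold fundamental group of the quotient orbifold of
   {x in D^n | x_i <> g x_j for all g in Z_m and i <> j} by the wreath product
   of Z_m and S_n, given by its presentation; the elements h_j and u of the
   topological group are fixed by this presentation. *)
Definition orbifold_braid_group (n m : nat) : groupType :=
  presented_group (@orbifold_braid_rel n m).

Section Elements.
Variables n m : nat.

Definition u_gen : orbifold_braid_group n m := word_class _ (u_word n).

Definition h_gen (j : nat) : orbifold_braid_group n m := word_class _ (h_word n j).

(* h_{j-1} ... h_1 u h_1 ... h_{j-1} *)
Definition gamma (j : nat) : orbifold_braid_group n m :=
  (\prod_(i <- rev (index_iota 1 j)) h_gen i) * u_gen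
    * (\prod_(1 <= i < j) h_gen i).

(* gamma_n ... gamma_1 *)
Definition theta : orbifold_braid_group n m :=
  \prod_(j <- rev (index_iota 1 n.+1)) gamma j.

End Elements.

(* Main.v *)
Require Import Defs.
From mathcomp Require Import all_boot.
From mathcomp Require Import boolp classical_sets.

Set Implicit Arguments.
Unset Strict Implicit.
Unset Printing Implicit Defensive.

Local Open Scope group_scope.

(** Two identities drive the proof: [gamma (j + 1) = h_j * gamma j * h_j], and
the fact that [gamma j] commutes with [h_i] unless [i] is [j - 1] or [j].  For
[i > j] the latter is clear from the far commutation relations; for
[i = j - 2] it is the braid relation used twice, and every further conjugating
letter commutes with [h_i].

Consequently the [gamma j] commute with each other ([gamma_comm]): the relation
[[h_1 u h_1, u] = 1] says that [gamma 2] commutes with [gamma 1 = u], and all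
other cases follow by moving letters [h_k] past a [gamma j] with [j >= k + 2].
In particular [u] commutes with [theta].

The letter [h_i] commutes with every factor of [theta] except the neighbours
[gamma (i + 1)] and [gamma i].  Writing [c] for [gamma i], their product is
[h_i c h_i c], and [gamma (i + 1)] and [gamma i] commute, so
[h_i c h_i c = c h_i c h_i]; this lets [h_i] pass through it.  So [theta] commutes
with the generators, hence with the whole group. *)

(** * Presented groups *)

Lemma commute_of_word_comm (X : choiceType) (R : word X -> word X -> Prop)
    (v w : word X) :
  R (word_comm v w) [::] -> commute (word_class R v) (word_class R w).
Proof.
move=> /word_class_rel; rewrite !word_class_cat !word_class_inv word_class_nil.
by move=> vw; apply/commgP; rewrite /commg /conjg mulgA -!mulgA vw.
Qed.

Lemma mem_center_presented_group (X : choiceType)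
    (R : word X -> word X -> Prop) (z : presented_group R) :
    (forall x : X, commute z (word_class R [:: (x, true)])) ->
  z \in center (presented_group R).
Proof.
move=> zX; rewrite inE => a; rewrite -[a]word_class_repr.
elim: (repr a) => [|[x b] w IHw]; first exact: commute1.
rewrite -cat1s word_class_cat; apply: commuteM => //.
case: b => //; rewrite -[[:: _]]/(word_inv [:: (x, true)]) word_class_inv.
exact/commuteV/zX.
Qed.

Lemma rev_index_iota1 (j : nat) :
  0 < j -> rev (index_iota 1 j.+1) = j :: rev (index_iota 1 j).
Proof.
case: j => // j _.
by rewrite /index_iota !subSS !subn0 -[in LHS](addn1 j) iotaD rev_cat add1n.
Qed.

(** * The elements gamma *)

Section OrbifoldBraidGroup.
Variables n m : nat.

Local Notation u := (u_gen n m).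
Local Notation h := (h_gen n m).
Local Notation gamma := (gamma n m).

Lemma h_braid (j : nat) :
  1 <= j -> j.+1 < n -> h j * h j.+1 * h j = h j.+1 * h j * h j.+1.
Proof.
move=> j1 jn; have jn2 : 2 <= j.+1 < n by rewrite ltnS j1.
rewrite -!mulgA; have := word_class_rel (RelBraid m jn2).
by rewrite !word_class_cat.
Qed.

Lemma h_far (k l : nat) : 1 <= k -> k.+1 < l -> l < n -> commute (h k) (h l).
Proof.
move=> k1 kl ln; apply/commute_of_word_comm/RelFar; rewrite ?addn2 ?kl //.
  by rewrite k1 (ltn_trans _ ln) // ltnW.
by rewrite ln (leq_trans _ kl).
Qed.

Lemma u_h_comm (j : nat) : 2 <= j < n -> commute u (h j).
Proof. by move=> jn; apply/commute_of_word_comm/RelUComm. Qed.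

Lemma gamma1 : gamma 1 = u.
Proof. by rewrite /gamma !big_nil mul1g mulg1. Qed.

Lemma gammaS (j : nat) : 0 < j -> gamma j.+1 = h j * gamma j * h j.
Proof.
by move=> j0; rewrite /gamma rev_index_iota1 // big_cons big_nat_recr //= !mulgA.
Qed.

Lemma h_gamma_comm_gt (i j : nat) :
  1 <= j -> j < i -> i < n -> commute (h i) (gamma j).
Proof.
elim: j => // -[|j] IHj _ ji lin.
  by rewrite gamma1; apply/commute_sym/u_h_comm/andP.
have hij : commute (h i) (h j.+1) by apply/commute_sym/h_far.
rewrite gammaS //; apply: commuteM => //; apply: commuteM => //.
by apply: IHj => //; apply: ltnW.
Qed.

(** Writing [c] for [gamma i] and [k] for [i + 1], the case [j = i + 2] is
[h_i h_k h_i c h_i h_k = h_k h_i h_k c h_i h_k = h_k h_i c h_k h_i h_k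
= h_k h_i c h_i h_k h_i]. *)
Lemma h_gamma_comm_lt (i j : nat) :
  1 <= i -> i.+1 < j -> j <= n -> commute (h i) (gamma j).
Proof.
move=> i1; elim: j => // j IHj; rewrite ltnS leq_eqVlt => /predU1P[<-|ij] jn.
  have br := h_braid i1 jn.
  have /esym kc : commute (h i.+1) (gamma i) by apply: h_gamma_comm_gt.
  rewrite !gammaS // /commute.
  transitivity (h i * h i.+1 * h i * gamma i * h i * h i.+1).
    by rewrite !mulgA.
  rewrite br -(mulgA _ (h i.+1) (gamma i)) -kc.
  transitivity (h i.+1 * h i * gamma i * (h i.+1 * h i * h i.+1)).
    by rewrite !mulgA.
  by rewrite -br !mulgA.
have hij : commute (h i) (h j) by apply: h_far.
rewrite gammaS; last by rewrite (leq_trans _ ij).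
apply: commuteM => //; apply: commuteM => //.
by apply: IHj => //; apply: ltnW.
Qed.

Lemma u_gamma_comm (j : nat) : 1 <= j -> j <= n -> commute u (gamma j).
Proof.
elim: j => // -[|[|j]] IHj _ jn; first by rewrite gamma1.
  rewrite gammaS // gamma1; apply: commute_sym.
  have := commute_of_word_comm (RelUH m jn).
  by rewrite !word_class_cat mulgA.
have uh : commute u (h j.+2) by apply: u_h_comm.
rewrite gammaS //; apply: commuteM => //; apply: commuteM => //.
by apply: IHj => //; apply: ltnW.
Qed.

Lemma gamma_comm (k j : nat) :
  1 <= k -> k < j -> j <= n -> commute (gamma k) (gamma j).
Proof.
elim: k => // -[|k] IHk _ kj jn.
  by rewrite gamma1; apply: u_gamma_comm => //; apply: ltnW.
have hj : commute (gamma j) (h k.+1) by apply/commute_sym/h_gamma_comm_lt.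
rewrite gammaS //; apply: commute_sym.
apply: commuteM => //; apply: commuteM => //; apply: commute_sym.
by apply: IHk => //; apply: ltnW.
Qed.

(** [h_i] need not commute with either factor alone.  With [c] for [gamma i],
commutation of the factors turns [h_i c h_i c] into [c h_i c h_i]. *)
Lemma h_gamma_pair_comm (i : nat) :
  1 <= i -> i < n -> commute (h i) (gamma i.+1 * gamma i).
Proof.
move=> i1 lin; have cc : commute (gamma i) (gamma i.+1) by apply: gamma_comm.
rewrite /commute -{1}cc gammaS //.
by rewrite !mulgA.
Qed.

(** * Commutation of the generators with theta *)

(** Not the element [theta] of the group on fewer strands: the partial products
all live in the same group, which makes induction on [k] possible. *)
Local Notation partial_theta k := (\prod_(j <- rev (index_iota 1 k.+1)) gamma j).

Lemma partial_thetaS (k : nat) :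
  partial_theta k.+1 = gamma k.+1 * partial_theta k.
Proof. by rewrite rev_index_iota1 // big_cons. Qed.

Lemma u_theta_comm (k : nat) : k <= n -> commute u (partial_theta k).
Proof.
elim: k => [|k IHk] kn; first by rewrite big_nil; apply: commute1.
rewrite partial_thetaS; apply: commuteM; first exact: u_gamma_comm.
exact/IHk/ltnW.
Qed.

Lemma h_theta_comm_gt (i k : nat) :
  k < i -> i < n -> commute (h i) (partial_theta k).
Proof.
move=> + lin; elim: k => [|k IHk] ki; first by rewrite big_nil; apply: commute1.
rewrite partial_thetaS; apply: commuteM; first exact: h_gamma_comm_gt.
exact/IHk/ltnW.
Qed.

(** False in general for [k = i], where only one of the two exceptional factors is present:
the induction has to start at [k = i + 1], with both of them. *)
Lemma h_theta_comm_lt (i k : nat) :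
  1 <= i -> i < k -> k <= n -> commute (h i) (partial_theta k).
Proof.
move=> i1; elim: k => // k IHk; rewrite ltnS leq_eqVlt => /predU1P[<-|ik] kn.
  rewrite partial_thetaS; case: i i1 kn {IHk} => // i _ lin.
  rewrite partial_thetaS mulgA; apply: commuteM.
    exact: h_gamma_pair_comm.
  exact: h_theta_comm_gt.
rewrite partial_thetaS; apply: commuteM; first exact: h_gamma_comm_lt.
exact/IHk/ltnW.
Qed.

End OrbifoldBraidGroup.

Theorem proposition4p1 (n m : nat) (hn : 1 <= n) (hm : 2 <= m) :
  theta n m \in center (orbifold_braid_group n m).
Proof.
apply: mem_center_presented_group => -[[j jn]|]; apply: commute_sym; last first.
  exact: u_theta_comm.
have -> : word_class (@orbifold_braid_rel n m)
    [:: (Some (exist _ j jn), true)] = h_gen n m j.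
  by rewrite /h_gen /h_word insubT.
by case/andP: (jn) => j1 ljn; apply: h_theta_comm_lt.
Qed.
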